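(* Let $\mathbf{X}=(X_n)_{n\ge 0}$ be an ergodic Markov chain with initial distribution $\nu$ and transition matrix $\mathbf{P}$ on a finite state space $\mathbb{E}=\{\mathbf{e}_1,\ldots,\mathbf{e}_M\}$, partially ordered by $\preceq$, with a unique maximal state $\mathbf{e}_M$, and let $\pi$ be its stationary distribution. Assume that (i) the function $g(\mathbf{e})=\nu(\mathbf{e})/\pi(\mathbf{e})$ is $\downarrow$-Möbius monotone, (ii) the time reversed chain, with transition matrix $\overleftarrow{\mathbf{P}}$, is $\downarrow$-Möbius monotone. Then there exists a Strong Stationary Dual chain $\mathbf{X}^*$ with initial distribution $\nu^*$ and transition matrix $\mathbf{P}^*$ on $\mathbb{E}^*=\mathbb{E}$, with respect to the link kernel $$\Lambda(\mathbf{e}_j,\mathbf{e}_i)=\mathbb{I}(\mathbf{e}_i\preceq \mathbf{e}_j)\,\frac{\pi(\mathbf{e}_i)}{H(\mathbf{e}_j)},\qquad H(\mathbf{e}_j)=\sum_{\mathbf{e}:\,\mathbf{e}\preceq \mathbf{e}_j}\pi(\mathbf{e}).$$ Moreover, the Strong Stationary Dual (with respect to this link) is uniquely determined by $$\nu^*(\mathbf{e}_i)=H(\mathbf{e}_i)\sum_{\mathbf{e}:\,\mathbf{e}\succeq \mathbf{e}_i}\mu(\mathbf{e}_i,\mathbf{e})\,g(\mathbf{e}),\qquad \mathbf{e}_i\in\mathbb{E},$$ $$\mathbf{P}^*(\mathbf{e}_i,\mathbf{e}_j)=\frac{H(\mathbf{e}_j)}{H(\mathbf{e}_i)}\sum_{\mathbf{e}:\,\mathbf{e}\succeq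 \mathbf{e}_j}\mu(\mathbf{e}_j,\mathbf{e})\,\overleftarrow{P}(\mathbf{e},\{\mathbf{e}_i\}^{\downarrow}),\qquad \mathbf{e}_i,\mathbf{e}_j\in\mathbb{E}.$$ The corresponding matrix formulas, with $\mathbf{g}=(g(\mathbf{e}_1),\ldots,g(\mathbf{e}_M))$ and $\mathbf{H}=(H(\mathbf{e}_1),\ldots,H(\mathbf{e}_M))=\pi\mathbf{C}$ (row vectors), are $$\nu^*=\mathbf{g}(\mathbf{C}^T)^{-1}\,\mathrm{diag}(\pi\mathbf{C}),$$ $$\mathbf{P}^*=\big(\mathrm{diag}(\mathbf{H})\,\mathbf{C}^{-1}\overleftarrow{\mathbf{P}}\,\mathbf{C}\,\mathrm{diag}(\mathbf{H})^{-1}\big)^T=\mathrm{diag}(\pi\mathbf{C})^{-1}\big(\mathbf{C}^T\mathrm{diag}(\pi)\big)\,\mathbf{P}\,\big(\mathbf{C}^T\mathrm{diag}(\pi)\big)^{-1}\mathrm{diag}(\pi\mathbf{C}).$$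
   Context: The states of the finite poset $(\mathbb{E},\preceq)$ are enumerated consistently with the order: $\mathbf{e}_i\preceq\mathbf{e}_j$ with $i\neq j$ implies $i<j$. All matrices and row vectors are indexed using this enumeration; functions and measures on $\mathbb{E}$ are identified with row vectors. Zeta and Möbius functions: $\mathbf{C}$ is the matrix with $\mathbf{C}(\mathbf{e}_i,\mathbf{e}_j)=1$ if $\mathbf{e}_i\preceq\mathbf{e}_j$ and $0$ otherwise; it is upper triangular and invertible. The Möbius function $\mu$ of the poset is given by $\mu(\mathbf{e}_i,\mathbf{e}_j)=\mathbf{C}^{-1}(\mathbf{e}_i,\mathbf{e}_j)$. Möbius monotonicity: a function $f:\mathbb{E}\to\mathbb{R}$, with $\mathbf{f}=(f(\mathbf{e}_1),\ldots,f(\mathbf{e}_M))$, is $\downarrow$-Möbius monotone if $\mathbf{f}(\mathbf{C}^T)^{-1}\ge 0$ entrywise. A transition matrix $\mathbf{Q}$ on $\mathbb{E}$ (or the Markov chain with this transition matrix) is $\downarrow$-Möbius monotone if $\mathbf{C}^{-1}\mathbf{Q}\mathbf{C}\ge 0$ entrywise. Notation: $\{\mathbf{e}_i\}^{\downarrow}=\{\mathbf{e}\in\mathbb{E}:\mathbf{e}\preceq\mathbf{e}_i\}$; $\mathbb{I}(\cdot)$ is the indicator; $\mathrm{diag}(v)$ is the diagonal matrix with the vector $v$ on the diagonal. The time reversed chain has transition matrix $\overleftarrow{\mathbf{P}}=(\mathrm{diag}(\pi))^{-1}\mathbf{P}^T\,\mathrm{diag}(\pi)$, and $\overleftarrow{P}(\mathbf{e},A)=\sum_{\mathbf{e}'\in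 A}\overleftarrow{\mathbf{P}}(\mathbf{e},\mathbf{e}')$ for $A\subseteq\mathbb{E}$. Strong Stationary Dual: let $\mathbf{X}^*$ be a Markov chain with initial distribution $\nu^*$ and transition matrix $\mathbf{P}^*$ on a finite state space $\mathbb{E}^*$ having an absorbing state $\mathbf{e}^*_a$, and let the link $\Lambda(\mathbf{e}^*,\mathbf{e})$, $\mathbf{e}^*\in\mathbb{E}^*$, $\mathbf{e}\in\mathbb{E}$, be a stochastic kernel (each $\Lambda(\mathbf{e}^*,\cdot)$ is a probability measure on $\mathbb{E}$) with $\Lambda(\mathbf{e}^*_a,\cdot)=\pi$. Then $\mathbf{X}^*$ (or $(\nu^*,\mathbf{P}^* )$) is a Strong Stationary Dual of $(\nu,\mathbf{P})$ with respect to $\Lambda$ if $\nu=\nu^*\Lambda$ and $\Lambda\mathbf{P}=\mathbf{P}^*\Lambda$. *)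

(* Defs.v *)
From mathcomp Require Import all_boot all_order all_algebra.
Set Implicit Arguments.
Unset Strict Implicit.
Unset Printing Implicit Defensive.
Import Order.TTheory GRing.Theory Num.Theory.
Local Open Scope ring_scope.

Section Chains.
Variable R : realFieldType.

Definition distribution (m : nat) (v : 'rV[R]_m) : Prop :=
  (forall i, 0 <= v 0 i) /\ \sum_i v 0 i = 1.

(* Rectangular, so that it covers transition matrices and links between two
   different state spaces. *)
Definition stochastic (m n : nat) (A : 'M[R]_(m, n)) : Prop :=
  forall i, distribution (row i A).

(* A time-homogeneous chain is identified with its initial distribution and
   its transition matrix. *)
Definition markov_chain (m : nat) (nu : 'rV[R]_m) (P : 'M[R]_m) : Prop :=
  distribution nu /\ stochastic P.

Definition irreducible (n : nat) (P : 'M[R]_n.+1) : Prop :=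
  forall i j, exists k : nat, 0 < (P ^+ k) i j.

(* The gcd of the return times to each state is 1. *)
Definition aperiodic (n : nat) (P : 'M[R]_n.+1) : Prop :=
  forall (i : 'I_n.+1) (d : nat),
    (forall k : nat, (0 < k)%N -> 0 < (P ^+ k) i i -> (d %| k)%N) -> d = 1%N.

Definition ergodic (n : nat) (P : 'M[R]_n.+1) : Prop :=
  irreducible P /\ aperiodic P.

Definition stationary (m : nat) (P : 'M[R]_m) (pi : 'rV[R]_m) : Prop :=
  distribution pi /\ pi *m P = pi.

Definition time_reversal (m : nat) (pi : 'rV[R]_m) (P : 'M[R]_m) : 'M[R]_m :=
  invmx (diag_mx pi) *m P^T *m diag_mx pi.

Definition absorbing (m : nat) (P : 'M[R]_m) (a : 'I_m) : Prop := P a a = 1.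

Definition strong_stationary_dual (m n : nat) (pi nu : 'rV[R]_n)
    (P : 'M[R]_n) (Lambda : 'M[R]_(m, n)) (nuS : 'rV[R]_m) (PS : 'M[R]_m)
    : Prop :=
  [/\ markov_chain nuS PS,
      stochastic Lambda,
      exists a : 'I_m, absorbing PS a /\ row a Lambda = pi,
      nu = nuS *m Lambda &
      Lambda *m P = PS *m Lambda].

End Chains.

Section Moebius.
Variables (R : realFieldType) (disp : Order.disp_t) (E : finPOrderType disp).
Variables (n : nat) (e : 'I_n -> E).

(* The state [e i] is represented by its index [i]: a function or measure on
   [E] is a row vector, a kernel is a matrix. *)
Definition consistent_enum : Prop :=
  bijective e /\ forall i j, (e i <= e j)%O -> i != j -> (i < j)%N.

Definition unique_maximal (x : E) : Prop :=
  forall y : E, (forall z : E, (y <= z)%O -> z = y) <-> y = x.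

Definition zeta_mx : 'M[R]_n := \matrix_(i, j) (e i <= e j)%O%:R.

(* [invmx A] is [A] itself when [A] is singular; this does not occur here. *)
Lemma zeta_mx_unit : consistent_enum -> zeta_mx \in unitmx.
Proof.
move=> [_ he]; rewrite -unitmx_tr unitmxE det_trig.
  by rewrite big1 ?unitr1 // => i _; rewrite !mxE lexx.
apply/is_trig_mxP => i j ltij; rewrite !mxE.
case: (boolP (e j <= e i)%O) => // leji; have := he _ _ leji.
by rewrite eq_sym neq_ltn ltij ltnNge (ltnW ltij) => /(_ isT).
Qed.

Definition mobius (i j : 'I_n) : R := invmx zeta_mx i j.

Definition fun_mobius_monotone (f : 'rV[R]_n) : Prop :=
  forall j, 0 <= (f *m invmx zeta_mx^T) 0 j.

Definition mx_mobius_monotone (Q : 'M[R]_n) : Prop :=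
  forall i j, 0 <= (invmx zeta_mx *m Q *m zeta_mx) i j.

Definition down_set (x : E) : {set E} := [set y | (y <= x)%O].

Definition kernel_prob (Q : 'M[R]_n) (i : 'I_n) (A : {set E}) : R :=
  \sum_(k | e k \in A) Q i k.

Definition cumul (pi : 'rV[R]_n) : 'rV[R]_n :=
  \row_j \sum_(k | (e k <= e j)%O) pi 0 k.

Definition truncation_link (pi : 'rV[R]_n) : 'M[R]_n :=
  \matrix_(j, i) ((e i <= e j)%O%:R * (pi 0 i / cumul pi 0 j)).

Definition density (nu pi : 'rV[R]_n) : 'rV[R]_n :=
  \row_i (nu 0 i / pi 0 i).

End Moebius.

Arguments zeta_mx R {disp E n} e.
Arguments mobius R {disp E n} e i j.

(* Main.v *)
(* Writing [L] for the link, [L = diag(H)^-1 C^T diag(pi)] is invertible because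
   irreducibility makes [pi] positive.  Hence [nu = nuS L] and [L P = PS L] have
   exactly one solution, [nuS = nu L^-1] and [PS = L P L^-1].  The monotonicity
   assumptions are exactly the nonnegativity of these two, and
   their row sums are 1 because [L] and [P] fix the all-ones vector.  The row of
   [L] at the maximal state is [pi], and [pi P = pi] makes that state absorbing
   for [PS]. *)
Require Import Defs.
From mathcomp Require Import all_boot all_order all_algebra.
Set Implicit Arguments.
Unset Strict Implicit.
Unset Printing Implicit Defensive.
Import Order.TTheory GRing.Theory Num.Theory.
Local Open Scope ring_scope.

Section Stochastic.
Variable R : realFieldType.

(** Row sums are expressed through the all-ones column, so that those of a matrix product follow by
    associativity. *)
Lemma stochasticP (m n : nat) (A : 'M[R]_(m, n)) :
  stochastic A <->
  (forall i j, 0 <= A i j) /\ A *m const_mx 1 = const_mx 1 :> 'cV_m.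
Proof.
have rowsum i : (A *m const_mx 1 : 'cV_m) i 0 = \sum_j row i A 0 j.
  by rewrite mxE; apply: eq_bigr => j _; rewrite !mxE mulr1.
split=> [sA | [A_ge0 A1] i].
  split=> [i j|]; first by have [/(_ j)] := sA i; rewrite mxE.
  by apply/colP => i; rewrite rowsum [RHS]mxE; have [] := sA i.
by split=> [j|]; rewrite ?mxE // -rowsum A1 mxE.
Qed.

Lemma expmx_ge0 (n : nat) (P : 'M[R]_n.+1) (k : nat) :
  (forall i j, 0 <= P i j) -> forall i j, 0 <= (P ^+ k) i j.
Proof.
move=> P_ge0; elim: k => [|k IHk] i j.
  by rewrite expr0 mxE ler0n.
by rewrite exprS -mulmxE mxE sumr_ge0 // => l _; rewrite mulr_ge0.
Qed.

Lemma stationary_expmx (n : nat) (P : 'M[R]_n.+1) (pi : 'rV[R]_n.+1) (k : nat) :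
  pi *m P = pi -> pi *m P ^+ k = pi.
Proof.
move=> piP; elim: k => [|k IHk]; first by rewrite expr0 mulmx1.
by rewrite exprS -mulmxE mulmxA piP.
Qed.

(** Total mass 1 gives a state [i] with [pi 0 i > 0]. Irreducibility gives [k] with
    [(P ^+ k) i j > 0], and [pi = pi P^k] then bounds [pi 0 j] below by the product of the two. *)
Lemma stationary_gt0 (n : nat) (P : 'M[R]_n.+1) (pi : 'rV[R]_n.+1) :
  stochastic P -> irreducible P -> stationary P pi -> forall j, 0 < pi 0 j.
Proof.
move=> /stochasticP[P_ge0 _] irrP [[pi_ge0 pi1] piP] j.
have [i pi_i_neq0] : exists i, pi 0 i != 0.
  apply/existsP; rewrite -negb_forall; apply/negP => /forallP pi0.
  move/eqP: pi1; rewrite big1 ?(eq_sym 0) ?oner_eq0 // => i _; exact/eqP/pi0.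
have [k Pk_gt0] := irrP i j.
rewrite -(stationary_expmx k piP) mxE (bigD1 i) //= ltr_wpDr //.
  by rewrite sumr_ge0 // => l _; rewrite mulr_ge0 ?expmx_ge0.
by rewrite mulr_gt0 // lt_def pi_i_neq0 pi_ge0.
Qed.

Lemma unitmx_diag_gt0 (m : nat) (v : 'rV[R]_m) :
  (forall i, 0 < v 0 i) -> diag_mx v \in unitmx.
Proof.
move=> v_gt0; rewrite unitmxE det_diag unitfE; apply/prodf_neq0 => i _.
by rewrite gt_eqF.
Qed.

Lemma invmx_diag_gt0 (m : nat) (v : 'rV[R]_m) :
  (forall i, 0 < v 0 i) -> invmx (diag_mx v) = diag_mx (\row_i (v 0 i)^-1).
Proof.
move=> v_gt0; apply: (can_inj (mulKmx (unitmx_diag_gt0 v_gt0))).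
rewrite mulmxV ?unitmx_diag_gt0 // mulmx_diag -diag_const_mx.
by congr diag_mx; apply/rowP => i; rewrite !mxE divff // gt_eqF.
Qed.

Lemma invmx_mul (m : nat) (A B : 'M[R]_m) :
  A \in unitmx -> B \in unitmx -> invmx (A *m B) = invmx B *m invmx A.
Proof.
move=> A_unit B_unit; have AB_unit : A *m B \in unitmx.
  by rewrite unitmx_mul A_unit.
by apply: (can_inj (mulKmx AB_unit)); rewrite mulmxV // mulmxA mulmxK ?mulmxV.
Qed.

Lemma mul_invmx_trmx (m : nat) (f : 'rV[R]_m) (A : 'M[R]_m) (j : 'I_m) :
  (f *m invmx A^T) 0 j = \sum_k invmx A j k * f 0 k.
Proof.
by rewrite -trmx_inv mxE; apply: eq_bigr => k _; rewrite mxE mulrC.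
Qed.

End Stochastic.

Section Enumeration.
Variables (R : realFieldType) (disp : Order.disp_t) (E : finPOrderType disp).
Variables (n : nat) (e : 'I_n -> E).
Hypothesis he : consistent_enum e.

(* The maximal state above [e i] is found as the state of largest index among
   those above [e i]. *)
Lemma le_unique_maximal (x : E) (i : 'I_n) : unique_maximal x -> (e i <= x)%O.
Proof.
have [[f fK eK] e_lt] := he => max_x.
case: (@arg_maxnP _ i (fun j => e i <= e j)%O val (lexx _)) => j leij max_j.
suff <- : e j = x by [].
apply/max_x => z; rewrite -(eK z) => lejk; congr e; apply/eqP.
have := max_j _ (le_trans leij lejk).
by case: eqVneq => // nejk /=; rewrite leqNgt e_lt // eq_sym.
Qed.

(** Strong induction on [j], using entry [(i, j)] of [C^-1 C = 1]. A nonzero [C k j] with [k != j]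
    forces [k < j], and [e i] is not below [e k] by transitivity, so that term vanishes by
    induction. Only [mu i j] remains, and [i != j] by reflexivity. *)
Lemma mobius_eq0 (i j : 'I_n) : ~~ (e i <= e j)%O -> mobius R e i j = 0.
Proof.
have [m] := ubnP (j : nat); elim: m j => // m IHm j lejm nleij.
have := congr1 (fun A : 'M[R]_n => A i j) (mulVmx (zeta_mx_unit R he)).
rewrite mxE (bigD1 j) //= big1 => [|k nekj].
  rewrite !mxE lexx mulr1 addr0 /mobius => ->.
  by case: eqVneq nleij => // ->; rewrite lexx.
rewrite mxE; case: (boolP (e k <= e j)%O) => lekj; last by rewrite mulr0.
rewrite [invmx _ _ _]IHm ?mul0r //.
  by rewrite (leq_trans (he.2 _ _ lekj nekj)) // -ltnS.
by apply: contra nleij => /le_trans; apply.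
Qed.

Lemma sum_mobius (i : 'I_n) (f : 'I_n -> R) :
  \sum_k mobius R e i k * f k =
  \sum_(k | (e i <= e k)%O) mobius R e i k * f k.
Proof.
rewrite [LHS](bigID (fun k => e i <= e k)%O) /= [X in _ + X]big1 ?addr0 //.
by move=> k /mobius_eq0->; rewrite mul0r.
Qed.

Lemma mulmx_zeta (Q : 'M[R]_n) (i j : 'I_n) :
  (Q *m zeta_mx R e) i j = kernel_prob e Q i (down_set (e j)).
Proof.
rewrite mxE [RHS]big_mkcond; apply: eq_bigr => k _.
by rewrite mxE inE; case: ifP => _; rewrite ?mulr1 ?mulr0.
Qed.

Lemma cumulE (pi : 'rV[R]_n) : cumul e pi = pi *m zeta_mx R e.
Proof.
apply/rowP => j; rewrite !mxE big_mkcond; apply: eq_bigr => k _.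
by rewrite mxE; case: ifP => _; rewrite ?mulr1 ?mulr0.
Qed.

Section Positive.
Variable pi : 'rV[R]_n.
Hypothesis pi_gt0 : forall i, 0 < pi 0 i.

Lemma cumul_gt0 (i : 'I_n) : 0 < cumul e pi 0 i.
Proof.
rewrite mxE (bigD1 i) ?lexx //= ltr_wpDr // sumr_ge0 // => k _.
exact: ltW.
Qed.

Lemma truncation_linkE :
  truncation_link e pi =
  invmx (diag_mx (cumul e pi)) *m ((zeta_mx R e)^T *m diag_mx pi).
Proof.
rewrite (invmx_diag_gt0 cumul_gt0); apply/matrixP => j i.
by rewrite mul_diag_mx mul_mx_diag !mxE mulrA mulrC.
Qed.

Lemma truncation_link_unit : truncation_link e pi \in unitmx.
Proof.
rewrite truncation_linkE !unitmx_mul unitmx_inv unitmx_tr zeta_mx_unit //.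
by rewrite !unitmx_diag_gt0 //; apply: cumul_gt0.
Qed.

Lemma truncation_link_stochastic : stochastic (truncation_link e pi).
Proof.
move=> j; split=> [i|].
  rewrite mxE [truncation_link _ _ _ _]mxE.
  by rewrite mulr_ge0 ?ler0n // divr_ge0 // ltW // cumul_gt0.
have H_neq0 : cumul e pi 0 j != 0 by rewrite gt_eqF ?cumul_gt0.
(* The target 1 is written as [H_j / H_j] and the numerator expanded, so that the two sums agree
   term by term. *)
rewrite -[RHS](divff H_neq0) [X in _ = X / _]mxE mulr_suml [RHS]big_mkcond.
apply: eq_bigr => i _; rewrite mxE [truncation_link _ _ _ _]mxE.
by case: ifP => _; rewrite ?mul1r ?mul0r.
Qed.

End Positive.
End Enumeration.

Theorem theorem3p1 (R : realFieldType) (disp : Order.disp_t)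
    (E : finPOrderType disp) (n : nat) (e : 'I_n.+1 -> E)
    (he : consistent_enum e) (hmax : unique_maximal (e ord_max))
    (nu pi : 'rV[R]_n.+1) (P : 'M[R]_n.+1)
    (hX : markov_chain nu P) (hP : ergodic P) (hpi : stationary P pi)
    (hg : fun_mobius_monotone e (density nu pi))
    (hrev : mx_mobius_monotone e (time_reversal pi P)) :
  let C := zeta_mx R e in
  let mu := mobius R e in
  let g := density nu pi in
  let H := cumul e pi in
  let revP := time_reversal pi P in
  let Lambda := truncation_link e pi in
  H = pi *m C /\
  exists (nuS : 'rV[R]_n.+1) (PS : 'M[R]_n.+1),
    [/\ strong_stationary_dual pi nu P Lambda nuS PS,
        forall (nu' : 'rV[R]_n.+1) (P' : 'M[R]_n.+1),
          strong_stationary_dual pi nu P Lambda nu' P' ->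
          nu' = nuS /\ P' = PS,
        (forall i, nuS 0 i =
           H 0 i * \sum_(k | (e i <= e k)%O) mu i k * g 0 k) /\
        (forall i j, PS i j =
           H 0 j / H 0 i *
           \sum_(k | (e j <= e k)%O)
             mu j k * kernel_prob e revP k (down_set (e i))),
        nuS = g *m invmx C^T *m diag_mx (pi *m C) &
        PS = (diag_mx H *m invmx C *m revP *m C *m invmx (diag_mx H))^T /\
        PS = invmx (diag_mx (pi *m C)) *m (C^T *m diag_mx pi) *m P *m
             invmx (C^T *m diag_mx pi) *m diag_mx (pi *m C)].
Proof.
move=> C mu g H revP Lambda.
have [[nu_ge0 nu1] P_st] := hX; have [[_ pi1] piP] := hpi.
have pi_gt0 := stationary_gt0 P_st hP.1 hpi.
have HE : H = pi *m C by apply: cumulE.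
have H_gt0 : forall i, 0 < H 0 i by apply: cumul_gt0.
have C_unit : C \in unitmx by apply: zeta_mx_unit.
have CT_unit : C^T \in unitmx by rewrite unitmx_tr.
have Dpi_unit := unitmx_diag_gt0 pi_gt0.
have DH_unit := unitmx_diag_gt0 H_gt0.
have L_unit : Lambda \in unitmx by apply: truncation_link_unit.
have L_st : stochastic Lambda by apply: truncation_link_stochastic.
have LE : Lambda = invmx (diag_mx H) *m (C^T *m diag_mx pi).
  exact: truncation_linkE.
have LV : invmx Lambda = invmx (C^T *m diag_mx pi) *m diag_mx H.
  apply: (can_inj (mulKmx L_unit)); rewrite mulmxV // LE -mulmxA.
  by rewrite mulKVmx ?mulVmx // unitmx_mul CT_unit.
split=> //.
pose nuS := g *m invmx C^T *m diag_mx H.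
pose PS := Lambda *m P *m invmx Lambda.
have nuSL : nuS *m Lambda = nu.
  rewrite LE /nuS -!mulmxA mulKVmx // mulKmx // mul_mx_diag.
  by apply/rowP => i; rewrite !mxE divfK // gt_eqF.
have PSL : Lambda *m P = PS *m Lambda by rewrite mulmxKV.
(* Transposition turns [revP] into [diag(pi) P diag(pi)^-1], so the right-hand side is [L P L^-1]
   with [L] factored. *)
have PSE : PS =
    (diag_mx H *m invmx C *m revP *m C *m invmx (diag_mx H))^T.
  rewrite /PS LV LE /revP /time_reversal !trmx_mul !trmx_inv !tr_diag_mx trmxK.
  by rewrite invmx_mul // !mulmxA.
(* A positive ratio times the entry with swapped indices, whose sign is given by [hrev]. *)
have PSij i j : PS i j = H 0 j / H 0 i * (invmx C *m revP *m C) j i.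
  rewrite PSE mxE invmx_diag_gt0 // mul_mx_diag mxE -!mulmxA mul_diag_mx.
  by rewrite !mulmxA [X in X * _]mxE [X in _ * X = _]mxE mulrAC.
have nuSi i : nuS 0 i = H 0 i * (g *m invmx C^T) 0 i.
  by rewrite /nuS mul_mx_diag [LHS]mxE mulrC.
(* Every state lies below the maximal one, so [H] there is the total mass 1. *)
have L_max : row ord_max Lambda = pi.
  have le_max i : (e i <= e ord_max)%O by apply: le_unique_maximal.
  apply/rowP => i; rewrite !mxE le_max mul1r (eq_bigl xpredT) ?pi1 ?divr1 //.
have /stochasticP[_ L1] := L_st; have /stochasticP[_ P1] := P_st.
exists nuS, PS; split=> [|nu' P' [_ _ _ nuL' PL']|||].
- split=> //.
  + split.
      split=> [i|]; first by rewrite nuSi (mulr_ge0 _ (hg i)) // ltW.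
      have sumE (v : 'rV[R]_n.+1) :
        \sum_i v 0 i = (v *m const_mx 1 : 'rV_1) 0 0.
        by rewrite mxE; apply: eq_bigr => i _; rewrite mxE mulr1.
      (* With [1] the all-ones column: [nuS 1 = nuS L 1 = nu 1]. *)
      by rewrite sumE -L1 mulmxA nuSL -sumE.
    apply/stochasticP; split=> [i j|].
      by rewrite PSij (mulr_ge0 _ (hrev j i)) // divr_ge0 // ltW.
    (* Similarly [PS 1 = PS L 1 = L P 1 = L 1 = 1]. *)
    by rewrite -{1}L1 mulmxA -PSL -mulmxA P1.
  + exists ord_max; split=> //.
    (* This row is [pi P L^-1 = pi L^-1]; since [pi] is the same row of [L], it is that row of
       [L L^-1 = 1]. *)
    have : row ord_max PS = row ord_max 1%:M.
      by rewrite /PS !row_mul L_max piP -{1}L_max -row_mul mulmxV.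
    by move/rowP/(_ ord_max); rewrite mxE [RHS]mxE [RHS]mxE eqxx.
- split; apply: (can_inj (mulmxK L_unit)); first by rewrite nuSL.
  by rewrite -PL' -PSL.
- split=> [i|i j]; first by rewrite nuSi mul_invmx_trmx sum_mobius.
  (* Grouping as [C^-1 (revP C)] makes the right factor the probabilities of down-sets under
     [revP]. *)
  rewrite PSij -mulmxA [X in _ * X = _]mxE; congr (_ * _).
  rewrite -[RHS](sum_mobius he); apply: eq_bigr => k _; congr (_ * _).
  exact: mulmx_zeta.
- by rewrite -HE.
- by split=> //; rewrite -HE /PS LV LE !mulmxA.
Qed.
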